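(* Let $f:\mathbb{R}^n\to\mathbb{R}$ be a non-negative, non-decreasing, convex, continuous and differentiable function with $\nabla f(x)\ge\nabla f(x')$ coordinatewise whenever $x\ge x'$ coordinatewise. Let $A=(a_{ij})\in\mathbb{R}_{\ge 0}^{m\times n}$ have rows arriving online, each with at most $d$ non-zero entries. For the online minimization problem $\min\{f(x):Ax\ge \mathbf 1,\ x\ge 0\}$, the competitive ratio (expressed as optimum over algorithm's cost) of the primal algorithm defined in the context is $$\max_{c>0}\ \min_{z}\left(\frac{\min_{\ell=1}^n\left\{\frac{\nabla_\ell f(z)}{\nabla_\ell f(cz)}\right\}}{4\ln(1+2d^2)}-\frac{z^{\top}\nabla f(z)-f(z)}{f(cz)}\right).$$ That is, if $\overline{x}$ is the final solution of the algorithm and $\mathrm{OPT}=\min\{f(x):Ax\ge\mathbf 1,x\ge0\}$, then $\mathrm{OPT}$ is at least this quantity times $f(\overline{x})$.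
   Context: $\nabla_\ell f(z)$ is the $\ell$-th coordinate of $\nabla f(z)$. In the ratio, $z$ ranges over $\mathbb{R}^n_{\ge 0}$ (max/min understood as sup/inf, over points where the quotients are defined). Online model: row $t$ of $A$ is revealed at round $t$; the constraint $\sum_j a_{tj}x_j\ge1$ must be satisfied upon arrival, and coordinates of $x$ may only increase over time. Primal algorithm: start with $x=0$. At round $t$, while $\sum_{j=1}^n a_{tj}x_j<1$, increase a continuous time variable $\tau$ at rate $1$ and increase each $x_j$ with $a_{tj}>0$ at rate $\dfrac{\partial x_j}{\partial\tau}=\dfrac{a_{tj}x_j+\frac1d}{\nabla_jf(x)}$. The rates are taken to be well defined along the execution. *)

(* Defs.v *)
From HB Require Import structures.
From mathcomp Require Import all_boot all_order all_algebra.
From mathcomp Require Import all_classical all_reals all_analysis.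

Set Implicit Arguments.
Unset Strict Implicit.
Unset Printing Implicit Defensive.

Import Order.TTheory GRing.Theory Num.Theory.
Import numFieldNormedType.Exports.

Local Open Scope classical_set_scope.
Local Open Scope ring_scope.

Definition vle (R : realType) (n : nat) (x y : 'rV[R]_n) : Prop :=
  forall j, x 0 j <= y 0 j.

Definition nabla (R : realType) (n : nat) (f : 'rV[R]_n -> R)
    (z : 'rV[R]_n) (l : 'I_n) : R :=
  'D_(delta_mx 0 l) f z.

Definition row_dot (R : realType) (m n : nat) (A : 'M[R]_(m, n)) (t : 'I_m)
    (x : 'rV[R]_n) : R :=
  \sum_(j < n) A t j * x 0 j.

Definition feasible (R : realType) (m n : nat) (A : 'M[R]_(m, n)) :
    set 'rV[R]_n :=
  [set x | vle 0 x /\ forall t, 1 <= row_dot A t x].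

Definition opt (R : realType) (m n : nat) (f : 'rV[R]_n -> R)
    (A : 'M[R]_(m, n)) : \bar R :=
  ereal_inf [set (f x)%:E | x in feasible A].

(* The trajectory x is indexed by the continuous time tau; round t (rows are
   numbered from 0) occupies the time interval [T t, T t.+1], reduced to a
   point when the arriving constraint is already satisfied.  The rates are
   imposed strictly inside each round, together with continuity of x: at the
   instant a round starts they may be infinite, e.g. at x = 0 when the gradient
   of f vanishes at 0. *)
Record primal_execution (R : realType) (m n : nat) (f : 'rV[R]_n -> R)
    (A : 'M[R]_(m, n)) (d : nat) (T : nat -> R) (x : R -> 'rV[R]_n) : Prop :=
  PrimalExecution {
    pe_time0 : T 0%N = 0;
    pe_time_le : forall t : 'I_m, T t <= T t.+1;
    pe_init : x 0 = 0;
    pe_continuous : {within `[0, T m], continuous x};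
    pe_loop : forall (t : 'I_m) (tau : R),
      T t <= tau < T t.+1 -> row_dot A t (x tau) < 1;
    pe_exit : forall t : 'I_m, 1 <= row_dot A t (x (T t.+1));
    pe_rate_defined : forall (t : 'I_m) (tau : R) (j : 'I_n),
      T t < tau < T t.+1 -> 0 < A t j -> nabla f (x tau) j != 0;
    pe_rate : forall (t : 'I_m) (tau : R) (j : 'I_n),
      T t < tau < T t.+1 ->
      is_derive tau 1 (fun s : R => x s 0 j)
        (if 0 < A t j
         then (A t j * x tau 0 j + d%:R^-1) / nabla f (x tau) j
         else 0)
  }.

(* The minimum over l is over the defined quotients only; it is +oo when there
   is none, so that such a z does not contribute to the infimum over z. *)
Definition ratio_at (R : realType) (n : nat) (f : 'rV[R]_n -> R) (d : nat)
    (c : R) (z : 'rV[R]_n) : \bar R :=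
  ((\big[Order.min/+oo]_(l < n | nabla f (c *: z) l != 0%R)
      (nabla f z l / nabla f (c *: z) l)%:E)
     * ((4 * ln (1 + 2 * d%:R ^+ 2))^-1)%:E
   - ((\sum_(l < n) z 0%R l * nabla f z l - f z) / f (c *: z))%:E)%E.

Definition primal_ratio (R : realType) (n : nat) (f : 'rV[R]_n -> R)
    (d : nat) : \bar R :=
  ereal_sup
    [set ereal_inf
           [set ratio_at f d c z | z in [set z | vle 0 z /\ f (c *: z) != 0]]
    | c in [set c : R | 0 < c]].

(* Main.v *)
(* Weak duality for a convex f is used only through its tangent at z: for
   feasible y, f y >= f z - z.grad f(z) + y.grad f(z).  Taking c z equal to the
   final point xbar, it remains to bound y.w from below, where
   w = grad f(xbar) dominates the gradient along the run.  Follow along the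
   run the potential
     sum_j w_j y_j (ln (x_j + p y_j) - ln (x_j + (p + K) y_j)),
   with p = 1/d and K = 2d: it increases in total by at most
   ln (1 + K/p) y.w = ln (1 + 2d^2) y.w and, for d >= 2, at rate at
   least 5/8, while f(x) increases at rate at most 2.  Hence
   (5/4) (f xbar - f 0) <= 4 ln (1 + 2d^2) y.w; the factor 5/4 absorbs f 0 when
   f 0 <= (f xbar - f 0)/4.  When f 0 is larger, points u = c z with f u large
   show that the infimum over z is at most 1/5, and f 0 <= f y suffices.  For
   d = 1 the run stays below every feasible y, and the infimum is at most 1. *)
Require Import Defs.
From HB Require Import structures.
From mathcomp Require Import all_boot all_order all_algebra.
From mathcomp Require Import all_classical all_reals all_analysis.
From mathcomp Require Import ring lra.

Set Implicit Arguments.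
Unset Strict Implicit.
Unset Printing Implicit Defensive.

Import Order.TTheory GRing.Theory Num.Theory.
Import numFieldNormedType.Exports.

Local Open Scope classical_set_scope.
Local Open Scope ring_scope.

(** * Gradients and the tangent inequality of convex functions *)

Lemma derive_nabla (R : realType) (n : nat) (f : 'rV[R]_n -> R)
    (z v : 'rV[R]_n) :
  differentiable f z -> 'D_v f z = \sum_(l < n) v 0 l * nabla f z l.
Proof.
move=> df; rewrite deriveE// {1}(row_sum_delta v) linear_sum.
by apply: eq_bigr => l _; rewrite linearZ /nabla deriveE.
Qed.

(** For [0 < h <= 1], convexity bounds the difference quotient at [z] in direction [y - z] by
    [f y - f z]; then [h] tends to 0 from the right. *)
Lemma convex_tangent (R : realType) (n : nat) (f : 'rV[R]_n -> R)
    (z y : 'rV[R]_n) :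
  convex_function setT f -> differentiable f z ->
  f z + \sum_(l < n) (y 0 l - z 0 l) * nabla f z l <= f y.
Proof.
move=> cvx df.
have -> : \sum_(l < n) (y 0 l - z 0 l) * nabla f z l = 'D_(y - z) f z.
  by rewrite derive_nabla//; apply: eq_bigr => l _; rewrite !mxE.
rewrite -lerBrDl.
have dv : derivable f z (y - z) by exact: diff_derivable.
have right_lim := cvg_dnbhs_at_right dv.
rewrite /derive -(cvg_lim _ right_lim)//.
apply: limr_le; first exact: cvgP right_lim.
near=> h.
have h0 : 0 < h by near: h; exact: nbhs_right_gt.
have h1 : h <= 1 by near: h; exact: nbhs_right_le.
have h01 : Itv.spec (Itv.num_sem (R := R)) (Itv.Real `[0%Z, 1%Z]) h.
  by apply/andP; split; [exact: gtr0_real|rewrite in_itv /= ltW].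
have := cvx (Itv.mk h01) y z (mem_set I) (mem_set I).
have -> : (conv (Itv.mk h01) (y : convex_lmodType _) (z : convex_lmodType _))
    = h *: (y - z) + z :> 'rV[R]_n.
  by rewrite /conv /= /unstable.onem scalerBl scale1r scalerBr addrA addrAC.
rewrite convRE /= /unstable.onem => H.
rewrite -[_ *: _]/(_ * _) mulrC ler_pdivrMr//.
move: H; rewrite mulrBl mul1r mulrBl [h * f y]mulrC [h * f z]mulrC; lra.
Unshelve. all: by end_near. Qed.

Lemma ge0_nabla (R : realType) (n : nat) (f : 'rV[R]_n -> R)
    (z : 'rV[R]_n) (l : 'I_n) :
  (forall x y, vle x y -> f x <= f y) -> differentiable f z ->
  0 <= nabla f z l.
Proof.
move=> mono df.
have dv : derivable f z (delta_mx 0 l) by exact: diff_derivable.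
have right_lim := cvg_dnbhs_at_right dv.
rewrite /nabla /derive -(cvg_lim _ right_lim)//.
apply: limr_ge; first exact: cvgP right_lim.
near=> h.
have h0 : 0 < h by near: h; exact: nbhs_right_gt.
rewrite -[_ *: _]/(_ * _) mulr_ge0 ?invr_ge0 ?(ltW h0)// subr_ge0 mono// => j.
by rewrite !mxE lerDr mulr_ge0 ?(ltW h0)// ler0n.
Unshelve. all: by end_near. Qed.

Lemma is_derive_nabla_comp (R : realType) (n : nat) (f : 'rV[R]_n -> R)
    (x : R -> 'rV[R]_n) (v : 'I_n -> R) (s : R) :
  differentiable f (x s) ->
  (forall j, is_derive s 1 (fun u : R => x u 0 j) (v j)) ->
  is_derive s 1 (f \o x) (\sum_(j < n) v j * nabla f (x s) j).
Proof.
move=> df dx.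
have dxs : derivable x s 1.
  by apply/derivable_mxP => i j; rewrite ord1; exact: ex_derive.
have diffx : differentiable x s by exact/derivable1_diffP.
apply: DeriveDef.
  by apply/derivable1_diffP/differentiable_comp.
rewrite deriveE; last exact: differentiable_comp.
rewrite diff_comp//= -!deriveE// derive_nabla//.
by apply: eq_bigr => j _; rewrite derive_mx// mxE derive_val.
Qed.

(** * Monotonicity from the sign of a derivative *)

Lemma is_derive_ndecr (R : realType) (g dg : R -> R) (a b : R) :
  {within `[a, b], continuous g} ->
  (forall s, a < s < b -> is_derive s 1 g (dg s)) ->
  (forall s, a < s < b -> 0 <= dg s) ->
  forall s u, a <= s -> s <= u -> u <= b -> g s <= g u.
Proof.
move=> cg Dg dg0; apply: ger0_derive1_ndecr => // s.
  by rewrite in_itv => /= /Dg [].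
by rewrite in_itv => /= sab; rewrite derive1E; have [_ ->] := Dg _ sab; apply: dg0.
Qed.

(** The sign of the rate depends on [y] itself, so monotonicity first needs [al * y + p] to stay
    positive. *)
Lemma affine_growth_ndecr (R : realType) (y g : R -> R) (al p a b : R) :
  0 <= al -> 0 < p -> 0 <= y a ->
  {within `[a, b], continuous y} ->
  (forall s, a < s < b -> 0 <= g s) ->
  (forall s, a < s < b -> is_derive s 1 y ((al * y s + p) / g s)) ->
  forall s u, a <= s -> s <= u -> u <= b -> y s <= y u.
Proof.
move=> al0 p0 ya0 cy g0 Dy.
(* [psi ^+ 2] has derivative [2 * al * psi ^+ 2 / g >= 0], so [psi] cannot reach 0. *)
pose psi s := al * y s + p.
have affine_continuous : continuous (fun v : R => al * v + p).
  move=> v; apply: cvgD; last exact: cvg_cst.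
  by apply: cvgM; [exact: cvg_cst|exact: cvg_id].
have cpsi : {within `[a, b], continuous psi}.
  by apply: (@within_continuous_comp _ _ _ _ y (fun v : R => al * v + p)) => // v _;
    exact: affine_continuous.
have csqr : {within `[a, b], continuous (fun s => psi s ^+ 2)}.
  by apply: (@within_continuous_comp _ _ _ _ psi (fun v : R => v ^+ 2)) => // v _;
    exact: exprn_continuous.
have sqr_ndecr := @is_derive_ndecr R (fun s => psi s ^+ 2)
  (fun s => 2 * al * psi s ^+ 2 / g s) a b csqr.
have sqr_psi s : a <= s <= b -> 0 < psi s ^+ 2.
  move=> /andP[as_ sb]; apply: lt_le_trans (exprn_gt0 2 p0) _.
  apply: le_trans (_ : psi a ^+ 2 <= _).
    rewrite lerXn2r ?nnegrE ?(ltW p0) // /psi ?addr_ge0 ?mulr_ge0 ?lerDr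
      ?mulr_ge0 ?(ltW p0) //.
  apply: sqr_ndecr => // r rab.
    have Dr := Dy _ rab.
    rewrite /psi; apply: is_derive_eq.
    by rewrite /GRing.scale /= /psi; ring.
  by rewrite divr_ge0 ?g0 // mulr_ge0 ?sqr_ge0 // mulr_ge0.
have psi_gt0 s : a <= s <= b -> 0 < psi s.
  move=> /andP[as_ sb]; rewrite ltNge; apply/negP => psis.
  have [||r] := @IVT R psi a s 0 as_.
  - by apply: continuous_subspaceW cpsi; apply: subset_itvl; rewrite bnd_simp.
  - have psia : 0 <= psi a by rewrite addr_ge0 ?mulr_ge0 ?(ltW p0).
    by rewrite ge_min le_max psis psia orbT.
  - rewrite in_itv /= => /andP[ar rs] psir.
    by have := sqr_psi r; rewrite ar (le_trans rs sb) psir expr0n ltxx => /(_ isT).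
apply: is_derive_ndecr cy Dy _ => s sab.
by rewrite divr_ge0 ?g0// ltW// psi_gt0// !ltW//; case/andP: sab.
Qed.

(** * The ratio at a single point *)

(** One defined quotient suffices for the minimum to be attained, hence to be a real [rho]. Where
    the gradient at [c *: z] vanishes, the comparison with [rho] reduces to [0 <= nabla f z l]. *)
Lemma ratio_at_fin (R : realType) (n : nat) (f : 'rV[R]_n -> R) (d : nat)
    (c : R) (z : 'rV[R]_n) :
  (forall y l, 0 <= nabla f y l) ->
  (exists l, nabla f (c *: z) l != 0) ->
  exists rho : R, [/\ 0 <= rho,
    forall l, rho * nabla f (c *: z) l <= nabla f z l &
    ratio_at f d c z = (rho / (4 * ln (1 + 2 * d%:R ^+ 2)) -
      (\sum_(l < n) z 0%R l * nabla f z l - f z) / f (c *: z))%:E].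
Proof.
move=> nabla0 [l0 hl0].
pose F l := (nabla f z l / nabla f (c *: z) l)%:E.
have [l _ minE] := @eq_bigmin _ _ _ +oo%E l0
  (fun l => nabla f (c *: z) l != 0) F hl0 (fun l _ => leey _).
exists (nabla f z l / nabla f (c *: z) l); split.
- by rewrite divr_ge0.
- move=> k; have [->|k0] := eqVneq (nabla f (c *: z) k) 0.
    by rewrite mulr0.
  rewrite -ler_pdivlMr; last by rewrite lt_def k0 nabla0.
  rewrite -lee_fin -[X in (X <= _)%E]minE.
  exact: (@bigmin_le_cond _ _ _ _ _ (fun l => nabla f (c *: z) l != 0)).
- by rewrite /ratio_at minE /F -EFinM -EFinB.
Qed.

Lemma sum_scaler_nabla (R : realType) (n : nat) (f : 'rV[R]_n -> R)
    (a : R) (z y : 'rV[R]_n) :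
  \sum_(l < n) (a *: z) 0 l * nabla f y l =
  a * \sum_(l < n) z 0 l * nabla f y l.
Proof. by rewrite mulr_sumr; apply: eq_bigr => l _; rewrite mxE mulrA. Qed.

Lemma convex_tangent0 (R : realType) (n : nat) (f : 'rV[R]_n -> R)
    (z : 'rV[R]_n) :
  convex_function setT f -> differentiable f z ->
  f z - f 0 <= \sum_(l < n) z 0 l * nabla f z l.
Proof.
move=> cvx df; have := convex_tangent 0 cvx df.
have -> : \sum_(l < n) ((0 : 'rV[R]_n) 0 l - z 0 l) * nabla f z l =
    - \sum_(l < n) z 0 l * nabla f z l.
  by rewrite -sumrN; apply: eq_bigr => l _; rewrite mxE sub0r mulNr.
lra.
Qed.

(** With [u = c z], the tangent at [z], evaluated at 0 and at [u], bounds z.grad f(z) - f(z) below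
    by [- f 0] and, using also the tangent at [u], by [rho * (f u - f 0) - f u]. The first bound
    settles [rho <= 1], the second [rho > 1], so [rho] disappears from the result. *)
Lemma ratio_at_le (R : realType) (n : nat) (f : 'rV[R]_n -> R) (d : nat)
    (c : R) (u : 'rV[R]_n) :
  convex_function setT f -> (forall y, differentiable f y) ->
  (forall y l, 0 <= nabla f y l) ->
  0 < c -> vle 0 u -> f 0 < f u -> 0 <= f 0 ->
  0 < ln (1 + 2 * d%:R ^+ 2 : R) ->
  (4 * ln (1 + 2 * d%:R ^+ 2))^-1 * f u <= f u - f 0 ->
  (ratio_at f d c (c^-1 *: u) <=
   ((4 * ln (1 + 2 * d%:R ^+ 2))^-1 + f 0 / f u)%:E)%E.
Proof.
move=> cvx df nabla0 c0 u0 fu f0 L0 kfu.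
set k := (4 * _)^-1 in kfu *.
have k0 : 0 < k by rewrite invr_gt0 mulr_gt0.
set z := c^-1 *: u.
have cz : c *: z = u by rewrite /z scalerA divff ?scale1r ?gt_eqF.
have fu0 : 0 < f u by exact: le_lt_trans fu.
have tangent_u := convex_tangent0 cvx (df u).
(* A vanishing gradient at [u] would force [f u <= f 0] by the tangent inequality. *)
have nabla_u : exists l, nabla f (c *: z) l != 0.
  apply/existsP; rewrite cz -[X in is_true X]negbK negb_exists.
  apply/negP => /forallP nabla_eq0.
  move: tangent_u; rewrite big1 ?leNgt ?subr_gt0 ?fu// => l _.
  by have := nabla_eq0 l; rewrite negbK => /eqP ->; rewrite mulr0.
have [rho [rho0 rho_le ->]] := ratio_at_fin d nabla0 nabla_u.
rewrite lee_fin -/k cz.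
have tangent_z := convex_tangent0 cvx (df z).
set S := \sum_(l < n) _ in tangent_z *.
have tangent_zu : f z + (c - 1) * S <= f u.
  apply: le_trans (convex_tangent u cvx (df z)).
  rewrite lerD2l /S mulr_sumr le_eqVlt; apply/orP; left; apply/eqP.
  by apply: eq_bigr => l _; rewrite -cz !mxE; ring.
have cS : rho * (f u - f 0) <= c * S.
  apply: le_trans (ler_wpM2l rho0 tangent_u) _.
  rewrite -[X in _ <= X]sum_scaler_nabla cz mulr_sumr; apply: ler_sum => l _.
  rewrite mulrCA ler_wpM2l//; first by have := u0 l; rewrite mxE.
  by rewrite -{1}cz.
rewrite -(ler_pM2r fu0) [X in X <= _]mulrBl [X in _ <= X]mulrDl !divfK ?gt_eqF//.
have [rho1|rho1] := leP rho 1.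
  have : 0 <= (1 - rho) * (k * f u).
    by rewrite mulr_ge0 ?subr_ge0// mulr_ge0 ?(ltW k0) ?(ltW fu0).
  lra.
(* The ratio times [f u] is now at most [f u - rho * (f u - f 0 - k * f u)], which is largest at
   [rho = 1]. *)
have : 0 <= (rho - 1) * (f u - f 0 - k * f u) by rewrite mulr_ge0 ?subr_ge0 ?(ltW rho1).
lra.
Qed.

(** * Lower bounds on the logarithmic factor *)

Lemma ln_ge1BV (R : realType) (t : R) : 0 < t -> 1 - t^-1 <= ln t.
Proof.
move=> t0; have tV0 : 0 < t^-1 by rewrite invr_gt0.
have := @le_ln1Dx R (t^-1 - 1); rewrite [1 + _]addrC subrK lnV ?posrE//.
by move=> /(_ _) ln_le; have := ln_le ltac:(lra); lra.
Qed.

Lemma ln3_ge (R : realType) : 5 / 6 <= ln 3 :> R.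
Proof.
(* The bound [1 - t^-1] gives 1/3 + 1/2 on the two factors, but only 2/3 on 3 directly. *)
have -> : 3 = (3 / 2) * 2 :> R by field.
rewrite lnM ?posrE ?divr_gt0//.
have := @ln_ge1BV R (3 / 2); have := @ln_ge1BV R 2.
rewrite invf_div; lra.
Qed.

Lemma ln_coef_ge (R : realType) (d : nat) : (0 < d)%N ->
  5 / 6 <= ln (1 + 2 * d%:R ^+ 2) :> R.
Proof.
move=> d0; apply: le_trans (ln3_ge R) _.
have d1 : 1 <= d%:R :> R by rewrite ler1n.
by rewrite ler_ln ?posrE; nra.
Qed.

Lemma ln_coef_ge2 (R : realType) (d : nat) : (1 < d)%N ->
  5 / 3 <= ln (1 + 2 * d%:R ^+ 2) :> R.
Proof.
move=> d1.
have d2 : 2 <= d%:R :> R by rewrite (ler_nat R 2).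
(* For [d >= 2] the argument is at least 9, and [ln 9 = 2 * ln 3]. *)
apply: le_trans (_ : ln (3 ^+ 2) <= _).
  by rewrite lnXn// mulr2n; have := ln3_ge R; lra.
by rewrite ler_ln ?posrE; nra.
Qed.

(** * Growth of the cost and of the potential within one round *)

(* [m] plays the role of [min (al * y) 1]. *)
Lemma potential_rate_ge (R : realFieldType) (al x y g w p K m : R) :
  0 <= al -> 0 <= x -> 0 < y -> 0 < g -> g <= w -> 0 < p -> 0 < K ->
  0 <= m -> m <= al * y -> m <= 1 ->
  m * (1 - p / K) - al * x / K <=
  w * y * ((x + p * y)^-1 - (x + (p + K) * y)^-1) * ((al * x + p) / g).
Proof.
move=> al0 x0 y0 g0 gw p0 K0 m0 my m1.
have py0 : 0 < p * y by rewrite mulr_gt0.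
have Ky0 : 0 < K * y by rewrite mulr_gt0.
set A := x + p * y; set B := x + (p + K) * y.
have A0 : 0 < A by rewrite /A; lra.
have BE : B = A + K * y by rewrite /A /B; ring.
have B0 : 0 < B by rewrite BE; lra.
(* Uses [m / y <= al]. *)
apply: (@le_trans _ _ (m * (1 - A / (K * y)))).
  have -> : m * (1 - A / (K * y)) = m * (1 - p / K) - m / y * x / K.
    by rewrite /A; field; rewrite !gt_eqF.
  rewrite lerD2l lerN2 ler_pM2r ?invr_gt0// ler_wpM2r//.
  by rewrite ler_pdivrMr.
(* With [t = A / (K * y)] this is [1 - t <= 1 / (1 + t)]. *)
apply: (@le_trans _ _ (m * (K * y / B))).
  rewrite ler_wpM2l// ler_pdivlMr// BE.
  have -> : (1 - A / (K * y)) * (A + K * y) = K * y - A ^+ 2 / (K * y).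
    by field; rewrite !gt_eqF.
  by rewrite gerBl divr_ge0 ?sqr_ge0// ltW.
(* In this factorization [w / g] is at least 1, and the middle factor is at least [m] because [m]
   lies below both [al * y] and 1. *)
have -> : w * y * (A^-1 - B^-1) * ((al * x + p) / g) =
    (w / g) * ((y * (al * x + p) / A) * (K * y / B)).
  by rewrite BE; field; rewrite -?BE !gt_eqF.
have yA : m <= y * (al * x + p) / A.
  rewrite ler_pdivlMr// /A.
  have := ler_wpM2r x0 my; have := ler_wpM2r (ltW py0) m1; lra.
have KB0 : 0 <= K * y / B by rewrite divr_ge0 ?ltW.
apply: le_trans (ler_wpM2r KB0 yA) _.
rewrite ler_peMl ?ler_pdivlMr ?mul1r// mulr_ge0//.
exact: le_trans yA.
Qed.

(** A single term above 1 already suffices after capping; otherwise capping changes nothing. *)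
Lemma sum_minr1_ge1 (R : realDomainType) (n : nat) (b : 'I_n -> R) :
  (forall j, 0 <= b j) -> 1 <= \sum_(j < n) b j ->
  1 <= \sum_(j < n) Num.min (b j) 1.
Proof.
move=> b0 b1; have [/existsP[j bj]|small] := boolP [exists j, 1 < b j].
  rewrite (bigD1 j)//= (min_r (ltW bj)) lerDl sumr_ge0// => i _.
  by rewrite le_min b0 ler01.
rewrite (eq_bigr b)// => j _; apply: min_l.
by move: small; rewrite negb_exists => /forallP/(_ j); rewrite -leNgt.
Qed.

Lemma within_continuous_sum (R : realType) (n : nat) (h : 'I_n -> R -> R)
    (A : set R) :
  (forall i, {within A, continuous (h i)}) ->
  {within A, continuous (fun s => \sum_(i < n) h i s)}.
Proof.
move=> ch; rewrite -fct_sumE; elim/big_rec: _ => [|i g _ cg].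
  by move=> s; exact: cst_continuous.
exact: within_continuousD.
Qed.

Lemma is_derive_fun_sum (R : realType) (n : nat) (h : 'I_n -> R -> R)
    (dh : 'I_n -> R) (s : R) :
  (forall i, is_derive s 1 (h i) (dh i)) ->
  is_derive s 1 (fun s => \sum_(i < n) h i s) (\sum_(i < n) dh i).
Proof. by move=> Dh; rewrite -fct_sumE; exact: is_derive_sum. Qed.

Lemma within_continuous_coord (R : realType) (n : nat) (x : R -> 'rV[R]_n)
    (A : set R) (j : 'I_n) :
  {within A, continuous x} -> {within A, continuous (fun s => x s 0 j)}.
Proof.
move=> cx; apply: (@within_continuous_comp _ _ _ _ x (fun v => v 0 j)) => // v _.
exact: coord_continuous.
Qed.

(** In the chain rule the partial derivatives cancel the denominators of the rates. What remains is
    at most the row value, at most 1, plus [d^-1] for each of at most [d] nonzero entries. *)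
Lemma round_cost_le (R : realType) (n d : nat) (f : 'rV[R]_n -> R)
    (al : 'I_n -> R) (x : R -> 'rV[R]_n) (a b : R) :
  (0 < d)%N -> (forall y, differentiable f y) ->
  (forall j, 0 <= al j) -> (#|[pred j | al j != 0%R]| <= d)%N ->
  a <= b -> {within `[a, b], continuous x} ->
  (forall s, a < s < b -> \sum_(j < n) al j * x s 0 j <= 1) ->
  (forall s j, a < s < b -> 0 < al j -> nabla f (x s) j != 0) ->
  (forall s j, a < s < b -> is_derive s 1 (fun u : R => x u 0 j)
     (if 0 < al j then (al j * x s 0 j + d%:R^-1) / nabla f (x s) j else 0)) ->
  f (x b) - f (x a) <= 2 * (b - a).
Proof.
move=> d0 df al0 sparse ab cx row1 nabla_neq0 Dx.
pose v s j := if 0 < al j then (al j * x s 0 j + d%:R^-1) / nabla f (x s) j else 0.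
pose g s := 2 * s - f (x s).
suff : g a <= g b by rewrite /g; lra.
have cfx : {within `[a, b], continuous (f \o x)}.
  by apply: within_continuous_comp cx => u _; exact: differentiable_continuous.
apply: (@is_derive_ndecr _ g (fun s => 2 - \sum_(j < n) v s j * nabla f (x s) j)
  a b) => //.
- have -> : g = (fun s => 2 * s) - (f \o x) by [].
  apply: within_continuousB => //; apply: continuous_subspaceT => s.
  by apply: cvgM; [exact: cvg_cst|exact: cvg_id].
- move=> s sab; have Df := is_derive_nabla_comp (df (x s)) (Dx s ^~ sab).
  have -> : g = (fun s => 2 * s) - (f \o x) by [].
  by apply: is_derive_eq; rewrite /GRing.scale /=; ring.
- move=> s sab; rewrite subr_ge0.
  apply: (@le_trans _ _ (\sum_(j < n) (al j * x s 0 j + (al j != 0)%:R / d%:R))).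
    apply: ler_sum => j _; rewrite /v; case: ifPn => [aj|].
      by rewrite divfK ?nabla_neq0// gt_eqF// mul1r.
    by rewrite lt_def al0 andbT negbK => /eqP ->; rewrite eqxx !mul0r addr0.
  rewrite big_split/= -mulr_suml.
  have -> : \sum_(j < n) (al j != 0)%:R = #|[pred j | al j != 0%R]|%:R :> R.
    rewrite -natr_sum -sum1_card [in RHS]big_mkcond /=; congr _%:R.
  have : #|[pred j | al j != 0%R]|%:R / d%:R <= 1 :> R.
    by rewrite ler_pdivrMr ?ltr0n// mul1r ler_nat.
  by have := row1 s sab; lra.
Qed.

(* The subtracted logarithm is a smooth cap: it makes the potential bounded
   however far [v] overshoots [y]. *)
Definition potential (R : realType) (n : nat) (w : 'I_n -> R) (y : 'rV[R]_n)
    (p q : R) (v : 'rV[R]_n) : R :=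
  \sum_(j < n) w j * y 0 j *
    (ln (v 0 j + p * y 0 j) - ln (v 0 j + q * y 0 j)).

Lemma is_derive_potential_term (R : realType) (h : R -> R) (dh r y p q s : R) :
  0 <= h s -> 0 <= y -> 0 < p -> 0 < q -> is_derive s 1 h dh ->
  is_derive s 1 (fun u => r * y * (ln (h u + p * y) - ln (h u + q * y)))
    (r * y * ((h s + p * y)^-1 - (h s + q * y)^-1) * dh).
Proof.
move=> h0 y0 p0 q0 Dh.
(* For [y = 0] the arguments of [ln] may vanish, but the factor [y] makes the whole term zero. *)
have [->|yn0] := eqVneq y 0.
  rewrite mulr0 !mul0r; rewrite (_ : (fun _ => _) = cst 0).
    exact: is_derive_cst.
  by apply/funext => u; rewrite mul0r.
have ygt0 : 0 < y by rewrite lt_def yn0.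
have Dln c : 0 < c -> is_derive s 1 (fun u => ln (h u + c * y)) ((h s + c * y)^-1 * dh).
  move=> c0; apply: (@is_derive1_comp R (@ln R) (fun u => h u + c * y)).
    by apply: is_derive1_ln; rewrite ltr_wpDl ?mulr_gt0.
  by apply: is_derive_eq; rewrite addr0.
have Dp := Dln _ p0; have Dq := Dln _ q0.
by apply: is_derive_eq; rewrite /GRing.scale /=; ring.
Qed.

Lemma continuous_potential_term (R : realType) (h : R -> R) (A : set R)
    (r y p q : R) :
  (forall s, A s -> 0 <= h s) -> 0 <= y -> 0 < p -> 0 < q ->
  {within A, continuous h} ->
  {within A, continuous
    (fun u => r * y * (ln (h u + p * y) - ln (h u + q * y)))}.
Proof.
move=> h0 y0 p0 q0 ch.
have [->|yn0] := eqVneq y 0.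
  rewrite (_ : (fun _ => _) = cst 0).
    by move=> s; exact: cst_continuous.
  by apply/funext => u; rewrite mulr0 mul0r.
have ygt0 : 0 < y by rewrite lt_def yn0.
apply: (@within_continuous_comp _ _ _ _ h
  (fun v => r * y * (ln (v + p * y) - ln (v + q * y)))) => // v.
rewrite inE => -[s As <-].
have cln c : 0 < c -> {for h s, continuous (fun v : R => ln (v + c * y))}.
  move=> c0; apply: (@continuous_comp _ _ _ (fun v : R => v + c * y) (@ln R)).
    by apply: cvgD; [exact: cvg_id|exact: cvg_cst].
  by apply: continuous_ln; rewrite ltr_wpDl ?mulr_gt0 ?h0.
by apply: cvgM; [exact: cvg_cst|apply: cvgB; exact: cln].
Qed.

(** The coordinatewise rate bounds are summed with [m j = min (al j * y j) 1]: feasibility of [y]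
    makes the [m j] sum to at least 1, while the unsatisfied row keeps the sum of [al j * x j] at
    most 1. *)
Lemma round_potential_ge (R : realType) (n : nat) (f : 'rV[R]_n -> R)
    (al w : 'I_n -> R) (y : 'rV[R]_n) (x : R -> 'rV[R]_n) (a b p K : R) :
  (forall j, 0 <= al j) -> a <= b -> {within `[a, b], continuous x} ->
  (forall s, a <= s <= b -> vle 0 (x s)) ->
  (forall s, a < s < b -> \sum_(j < n) al j * x s 0 j <= 1) ->
  (forall s j, a < s < b -> 0 < al j -> 0 < nabla f (x s) j <= w j) ->
  (forall s j, a < s < b -> is_derive s 1 (fun u : R => x u 0 j)
     (if 0 < al j then (al j * x s 0 j + p) / nabla f (x s) j else 0)) ->
  0 < p -> 0 < K -> p <= K -> vle 0 y -> 1 <= \sum_(j < n) al j * y 0 j ->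
  (1 - p / K - K^-1) * (b - a) <=
  potential w y p (p + K) (x b) - potential w y p (p + K) (x a).
Proof.
move=> al0 ab cx x0 row1 nablaw Dx p0 K0 pK y0 rowy.
pose th := 1 - p / K - K^-1.
have yj j : 0 <= y 0 j by have := y0 j; rewrite mxE.
have xj s j : a <= s <= b -> 0 <= x s 0 j.
  by move=> /x0/(_ j); rewrite mxE.
have q0 : 0 < p + K by rewrite addr_gt0.
pose g s := potential w y p (p + K) (x s) - th * s.
suff : g a <= g b by rewrite /g /th; lra.
pose dterm s j := w j * y 0 j *
  ((x s 0 j + p * y 0 j)^-1 - (x s 0 j + (p + K) * y 0 j)^-1) *
  (if 0 < al j then (al j * x s 0 j + p) / nabla f (x s) j else 0).
have gE : g = (potential w y p (p + K) \o x) - (fun s => th * s) by [].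
apply: (@is_derive_ndecr _ g (fun s => \sum_(j < n) dterm s j - th) a b) => //.
- rewrite gE; apply: within_continuousB.
    apply: within_continuous_sum => j.
    apply: (@continuous_potential_term _ (fun s => x s 0 j)) => //.
      by move=> s; rewrite /= in_itv /=; exact: xj.
    exact: within_continuous_coord.
  apply: continuous_subspaceT => s.
  by apply: cvgM; [exact: cvg_cst|exact: cvg_id].
- move=> s sab; rewrite gE.
  have sab' : a <= s <= b by case/andP: sab => /ltW -> /ltW ->.
  have Dpot : is_derive s 1 (potential w y p (p + K) \o x) (\sum_(j < n) dterm s j).
    apply: is_derive_fun_sum => j.
    apply: (@is_derive_potential_term _ (fun s => x s 0 j)) => //.
      exact: xj.
    exact: Dx.
  by apply: is_derive_eq; rewrite /GRing.scale /=; ring.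
- move=> s sab; rewrite subr_ge0.
  have sab' : a <= s <= b by case/andP: sab => /ltW -> /ltW ->.
  pose m j := Num.min (al j * y 0 j) 1.
  have m_ge1 : 1 <= \sum_(j < n) m j.
    by apply: sum_minr1_ge1 => // j; rewrite mulr_ge0.
  apply: (@le_trans _ _ (\sum_(j < n) (m j * (1 - p / K) - al j * x s 0 j / K))).
    rewrite sumrB -!mulr_suml /th.
    have pK1 : 0 <= 1 - p / K by rewrite subr_ge0 ler_pdivrMr ?mul1r.
    have KV0 : 0 <= K^-1 by rewrite invr_ge0 ltW.
    have := ler_wpM2r pK1 m_ge1; have := ler_wpM2r KV0 (row1 s sab); lra.
  apply: ler_sum => j _; rewrite /dterm.
  have m_le : m j <= al j * y 0 j by rewrite ge_min lexx.
  have m_le1 : m j <= 1 by rewrite ge_min lexx orbT.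
  have m0 : 0 <= m j by rewrite le_min mulr_ge0 ?ler01.
  case: ifPn => [aj|].
    have [yj0|yjn0] := eqVneq (y 0 j) 0.
      have -> : m j = 0 by apply/eqP; rewrite eq_le m0 andbT (le_trans m_le)// yj0 mulr0.
      by rewrite yj0 !(mulr0, mul0r) sub0r oppr_le0 !mulr_ge0 ?invr_ge0 ?(ltW K0) ?xj.
    have /andP[nabla0 nabla_le] := nablaw s j sab aj.
    apply: potential_rate_ge => //; first exact: xj.
    by rewrite lt_def yjn0 yj.
  rewrite lt_def al0 andbT negbK => /eqP al_eq0.
  have -> : m j = 0 by apply/eqP; rewrite eq_le m0 andbT (le_trans m_le)// al_eq0 mul0r.
  by rewrite al_eq0 !(mulr0, mul0r) subr0.
Qed.

(** At any [v] the first logarithm is at most the second; at 0 their difference is exactly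
    [- ln (q / p)] wherever [y 0 j > 0]. *)
Lemma potential_le (R : realType) (n : nat) (w : 'I_n -> R)
    (y v : 'rV[R]_n) (p q : R) :
  (forall j, 0 <= w j) -> vle 0 y -> vle 0 v -> 0 < p -> p <= q ->
  potential w y p q v - potential w y p q 0 <=
  ln (q / p) * \sum_(j < n) y 0 j * w j.
Proof.
move=> w0 y0 v0 p0 pq; have q0 : 0 < q by exact: lt_le_trans pq.
rewrite /potential -sumrB mulr_sumr; apply: ler_sum => j _.
have yj : 0 <= y 0 j by have := y0 j; rewrite mxE.
have vj : 0 <= v 0 j by have := v0 j; rewrite mxE.
have [->|yn0] := eqVneq (y 0 j) 0; first by rewrite !(mulr0, mul0r) subrr.
have ygt0 : 0 < y 0 j by rewrite lt_def yn0.
have py : 0 < p * y 0 j by rewrite mulr_gt0.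
have qy : 0 < q * y 0 j by rewrite mulr_gt0.
rewrite mxE !add0r -mulrBr [y 0 j * w j]mulrC [X in _ <= X]mulrC ler_wpM2l ?mulr_ge0//.
rewrite !lnM ?posrE ?invr_gt0// lnV ?posrE//.
have : ln (v 0 j + p * y 0 j) <= ln (v 0 j + q * y 0 j).
  by rewrite ler_ln ?posrE ?ltr_wpDl// lerD2l ler_wpM2r.
lra.
Qed.

(** * Monotonicity of a run across rounds *)

Lemma run_time_le (R : realType) (m n d : nat) (f : 'rV[R]_n -> R)
    (A : 'M[R]_(m, n)) (T : nat -> R) (x : R -> 'rV[R]_n) :
  primal_execution f A d T x ->
  forall k l, (k <= l)%N -> (l <= m)%N -> T k <= T l.
Proof.
move=> run k; elim=> [|l IH]; first by rewrite leqn0 => /eqP ->.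
rewrite leq_eqVlt => /orP[/eqP -> //|kl] lm.
exact: le_trans (IH kl (ltnW lm)) (pe_time_le run (Ordinal lm)).
Qed.

Lemma run_round_continuous (R : realType) (m n d : nat) (f : 'rV[R]_n -> R)
    (A : 'M[R]_(m, n)) (T : nat -> R) (x : R -> 'rV[R]_n) (t : 'I_m) :
  primal_execution f A d T x -> {within `[T t, T t.+1], continuous x}.
Proof.
move=> run; apply: continuous_subspaceW (pe_continuous run) => s /=.
rewrite !in_itv /= => /andP[Tts sTt].
rewrite -(pe_time0 run) (le_trans _ Tts) ?(run_time_le run)// 1?ltnW//.
by rewrite (le_trans sTt)// (run_time_le run).
Qed.

Lemma run_coord_ndecr (R : realType) (m n d : nat) (f : 'rV[R]_n -> R)
    (A : 'M[R]_(m, n)) (T : nat -> R) (x : R -> 'rV[R]_n) (t : 'I_m)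
    (j : 'I_n) :
  (0 < d)%N -> (forall y l, 0 <= nabla f y l) ->
  primal_execution f A d T x -> 0 <= x (T t) 0 j ->
  forall s u, T t <= s -> s <= u -> u <= T t.+1 -> x s 0 j <= x u 0 j.
Proof.
move=> d0 nabla0 run x0.
have cx := within_continuous_coord (j := j) (run_round_continuous (t := t) run).
have := fun s => @pe_rate _ _ _ _ _ _ _ _ run t s j; have [aj|aj] := ltP 0 (A t j) => Dx.
  apply: (affine_growth_ndecr (ltW aj) _ x0 cx _ Dx) => [|s _].
    by rewrite invr_gt0 ltr0n.
  exact: nabla0.
exact: is_derive_ndecr cx Dx _.
Qed.

(** Nonnegativity at the start of a round makes the round nondecreasing, which hands nonnegativity
    on to the next round. *)
Lemma run_ge0 (R : realType) (m n d : nat) (f : 'rV[R]_n -> R)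
    (A : 'M[R]_(m, n)) (T : nat -> R) (x : R -> 'rV[R]_n) :
  (0 < d)%N -> (forall y l, 0 <= nabla f y l) ->
  primal_execution f A d T x ->
  forall k, (k <= m)%N -> vle 0 (x (T k)).
Proof.
move=> d0 nabla0 run; elim=> [_|k IH km] j.
  by rewrite (pe_time0 run) (pe_init run).
have := IH (ltnW km) j; rewrite mxE => xk0; apply: le_trans xk0 _.
apply: (run_coord_ndecr (t := Ordinal km) d0 nabla0 run) => //=.
  by have := IH (ltnW km) j; rewrite mxE.
exact: run_time_le run _ _ (leqnSn k) km.
Qed.

Lemma run_vle (R : realType) (m n d : nat) (f : 'rV[R]_n -> R)
    (A : 'M[R]_(m, n)) (T : nat -> R) (x : R -> 'rV[R]_n) :
  (0 < d)%N -> (forall y l, 0 <= nabla f y l) ->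
  primal_execution f A d T x ->
  forall k l, (k <= l)%N -> (l <= m)%N -> vle (x (T k)) (x (T l)).
Proof.
move=> d0 nabla0 run k; elim=> [|l IH].
  by rewrite leqn0 => /eqP -> _ j.
rewrite leq_eqVlt => /orP[/eqP -> //|kl] lm j; first exact: lexx.
apply: le_trans (IH kl (ltnW lm) j) _.
have := run_ge0 d0 nabla0 run (ltnW lm) j; rewrite mxE => xl0.
apply: (run_coord_ndecr (t := Ordinal lm) d0 nabla0 run) => //=.
exact: run_time_le run _ _ (leqnSn l) lm.
Qed.

(** The upper bound lets gradient monotonicity compare the gradient during the run with the final
    one. *)
Lemma run_round_bounds (R : realType) (m n d : nat) (f : 'rV[R]_n -> R)
    (A : 'M[R]_(m, n)) (T : nat -> R) (x : R -> 'rV[R]_n) (t : 'I_m) (s : R) :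
  (0 < d)%N -> (forall y l, 0 <= nabla f y l) ->
  primal_execution f A d T x -> T t <= s <= T t.+1 ->
  vle 0 (x s) /\ vle (x s) (x (T m)).
Proof.
move=> d0 nabla0 run /andP[Tts sTt].
have x0 j : 0 <= x (T t) 0 j.
  by have := run_ge0 d0 nabla0 run (ltnW (ltn_ord t)) j; rewrite mxE.
split=> j.
  rewrite mxE; apply: le_trans (x0 j) _.
  exact: (run_coord_ndecr d0 nabla0 run (x0 j)).
apply: le_trans (run_vle d0 nabla0 run (ltn_ord t) (leqnn m) j).
exact: (run_coord_ndecr d0 nabla0 run (x0 j)).
Qed.

Lemma run_row_le1 (R : realType) (m n d : nat) (f : 'rV[R]_n -> R)
    (A : 'M[R]_(m, n)) (T : nat -> R) (x : R -> 'rV[R]_n) (t : 'I_m) (s : R) :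
  primal_execution f A d T x -> T t < s < T t.+1 ->
  \sum_(j < n) A t j * x s 0 j <= 1.
Proof.
by move=> run /andP[/ltW ts st]; apply/ltW/(pe_loop run); rewrite ts st.
Qed.

(** * Cost and potential summed over all rounds *)

Lemma run_cost_le (R : realType) (m n d : nat) (f : 'rV[R]_n -> R)
    (A : 'M[R]_(m, n)) (T : nat -> R) (x : R -> 'rV[R]_n) :
  (0 < d)%N -> (forall y, differentiable f y) ->
  (forall i j, 0 <= A i j) ->
  (forall i, (#|[pred j | A i j != 0%R]| <= d)%N) ->
  primal_execution f A d T x ->
  f (x (T m)) - f 0 <= 2 * T m.
Proof.
move=> d0 df A0 sparse run.
suff H k : (k <= m)%N -> f (x (T k)) - f 0 <= 2 * T k by exact: H.
elim: k => [_|k IH km].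
  by rewrite (pe_time0 run) (pe_init run) subrr mulr0.
have := @round_cost_le R n d f (A (Ordinal km)) x (T k) (T k.+1) d0 df
  (A0 _) (sparse _) (pe_time_le run (Ordinal km))
  (run_round_continuous (t := Ordinal km) run)
  (fun s => @run_row_le1 _ _ _ _ _ _ _ _ (Ordinal km) s run)
  (fun s j => pe_rate_defined run (t := Ordinal km) (tau := s) (j := j))
  (fun s j => @pe_rate _ _ _ _ _ _ _ _ run (Ordinal km) s j).
have := IH (ltnW km); lra.
Qed.

(** Freezing the weights at the final gradient keeps the same potential in every round, so the
    per-round gains telescope. *)
Lemma run_potential_ge (R : realType) (m n d : nat) (f : 'rV[R]_n -> R)
    (A : 'M[R]_(m, n)) (T : nat -> R) (x : R -> 'rV[R]_n) (y : 'rV[R]_n)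
    (K : R) :
  (0 < d)%N -> (forall y l, 0 <= nabla f y l) ->
  (forall x y, vle x y -> forall l, nabla f x l <= nabla f y l) ->
  (forall i j, 0 <= A i j) ->
  primal_execution f A d T x -> feasible A y -> 0 < K -> d%:R^-1 <= K ->
  (1 - d%:R^-1 / K - K^-1) * T m <=
  potential (nabla f (x (T m))) y d%:R^-1 (d%:R^-1 + K) (x (T m)) -
  potential (nabla f (x (T m))) y d%:R^-1 (d%:R^-1 + K) 0.
Proof.
move=> d0 nabla0 nabla_mono A0 run [y0 rowy] K0 dK.
set pot := potential _ _ _ _; set th := 1 - _ - _.
suff H k : (k <= m)%N -> th * T k <= pot (x (T k)) - pot 0 by exact: H.
elim: k => [_|k IH km].
  by rewrite (pe_time0 run) (pe_init run) subrr mulr0.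
have p0 : 0 < d%:R^-1 :> R by rewrite invr_gt0 ltr0n.
have := @round_potential_ge R n f (A (Ordinal km)) (nabla f (x (T m))) y x
  (T k) (T k.+1) d%:R^-1 K (A0 _) (pe_time_le run (Ordinal km))
  (run_round_continuous (t := Ordinal km) run)
  (fun s sab => (run_round_bounds (t := Ordinal km) d0 nabla0 run sab).1)
  (fun s => @run_row_le1 _ _ _ _ _ _ _ _ (Ordinal km) s run) _
  (fun s j => @pe_rate _ _ _ _ _ _ _ _ run (Ordinal km) s j)
  p0 K0 dK y0 (rowy (Ordinal km)).
rewrite -/pot -/th => round.
have := IH (ltnW km).
suff : th * (T k.+1 - T k) <= pot (x (T k.+1)) - pot (x (T k)) by lra.
apply: round => s j sab aj.
rewrite lt_def nabla0 (pe_rate_defined run (t := Ordinal km) sab aj) /=.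
apply: nabla_mono; apply: (run_round_bounds (t := Ordinal km) d0 nabla0 run _).2.
by case/andP: sab => /ltW -> /ltW ->.
Qed.

(** * Rows with one entry, unboundedness of the objective, and the weighted cost bound *)

(** A row with one nonzero entry [a] raises only its own coordinate, and only while
    [a * x_j < 1 <= a * y_j]. *)
Lemma run_vle_feasible (R : realType) (m n : nat) (f : 'rV[R]_n -> R)
    (A : 'M[R]_(m, n)) (T : nat -> R) (x : R -> 'rV[R]_n) (y : 'rV[R]_n) :
  (forall y l, 0 <= nabla f y l) ->
  (forall i j, 0 <= A i j) ->
  (forall i, (#|[pred j | A i j != 0%R]| <= 1)%N) ->
  primal_execution f A 1 T x -> feasible A y -> vle (x (T m)) y.
Proof.
move=> nabla0 A0 sparse run [y0 rowy].
suff H k : (k <= m)%N -> vle (x (T k)) y by exact: H.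
elim: k => [_ j|k IH km j].
  by rewrite (pe_time0 run) (pe_init run).
pose t := Ordinal km.
have xj s i : T t <= s <= T t.+1 -> 0 <= x s 0 i.
  by move=> /(run_round_bounds (ltnSn 0) nabla0 run)[/(_ i)]; rewrite mxE.
have cx := within_continuous_coord (j := j) (run_round_continuous (t := t) run).
have kj := IH (ltnW km) j.
have := fun s => @pe_rate _ _ _ _ _ _ _ _ run t s j; have [aj Dx|aj Dx] := ltP 0 (A t j).
- have x_le s : T t <= s < T t.+1 -> x s 0 j <= y 0 j.
    move=> /[dup] sab /(pe_loop run) row_lt.
    rewrite -(ler_pM2l aj).
    apply: (@le_trans _ _ 1).
      apply: le_trans (ltW row_lt); rewrite /row_dot (bigD1 j)//= lerDl.
      rewrite sumr_ge0// => i _; rewrite mulr_ge0// xj//.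
      by case/andP: sab => -> /ltW ->.
    have := rowy t; rewrite /row_dot (bigD1 j)//= big1 ?addr0// => i ij.
    have [->|Ai] := eqVneq (A t i) 0; first by rewrite mul0r.
    have := sparse t; rewrite leqNgt => /negP[].
    apply: (@leq_trans #|[set i; j]%SET|); first by rewrite cards2 ij.
    apply: subset_leq_card; apply/fintype.subsetP => l; rewrite !inE.
    by case/orP => /eqP ->//; rewrite gt_eqF.
  (* The loop condition excludes the end of the round. If [x] exceeded [y] there, the intermediate
     value theorem would place the midpoint of the two values strictly earlier in the round. *)
  rewrite leNgt; apply/negP => yx.
  have := IVT (pe_time_le run t) cx (v := (x (T k.+1) 0 j + y 0 j) / 2).
  have kx : x (T k) 0 j <= x (T k.+1) 0 j by exact: le_trans kj (ltW yx).
  rewrite /= min_l// max_r// => /(_ _)[|s]; first by apply/andP; split; lra.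
  rewrite in_itv /= => /andP[ks sk] xs.
  have [sE|sn] := eqVneq s (T k.+1); first by move: xs; rewrite sE; lra.
  have := x_le s; rewrite /= ks lt_neqAle sn sk xs => /(_ isT); lra.
- apply: le_trans kj; rewrite -lerN2.
  have cNx : {within `[T t, T t.+1], continuous (fun s => - x s 0 j)}.
    by apply: (@within_continuous_comp _ _ _ _ (fun s => x s 0 j) -%R) => // v _;
      exact: opp_continuous.
  apply: (is_derive_ndecr (dg := fun=> 0) cNx) => //; last exact: (pe_time_le run t).
  by move=> s sab; have Dxs := Dx s sab; apply: is_derive_eq; rewrite oppr0.
Qed.

(* A coordinate that the first row raises has positive partial derivative, and
   the tangent inequality makes [f] unbounded in its direction. *)
Lemma run_unbounded (R : realType) (m n d : nat) (f : 'rV[R]_n -> R)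
    (A : 'M[R]_(m, n)) (T : nat -> R) (x : R -> 'rV[R]_n) (M : R) :
  (0 < m)%N -> (0 < d)%N -> (forall x, 0 <= f x) ->
  convex_function setT f -> (forall y, differentiable f y) ->
  (forall y l, 0 <= nabla f y l) -> (forall i j, 0 <= A i j) ->
  primal_execution f A d T x ->
  exists2 u, vle 0 u & M <= f u.
Proof.
move=> m0 d0 f0 cvx df nabla0 A0 run.
pose t := Ordinal m0.
have T01 : T 0%N < T 1%N.
  (* The start 0 violates the first constraint, so round 0 has positive length and an interior time
     where the rates are defined. *)
  rewrite lt_neqAle (pe_time_le run t) andbT; apply/eqP => T01.
  have := pe_exit run t; rewrite -T01 (pe_time0 run) (pe_init run).
  by rewrite /row_dot big1 ?ler10// => j _; rewrite mxE mulr0.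
have [j aj] : exists j, 0 < A t j.
  apply/existsP; rewrite -[X in is_true X]negbK negb_exists.
  apply/negP => /forallP A_eq0.
  have := pe_exit run t; rewrite /row_dot big1 ?ler10// => j _.
  by have := A_eq0 j; rewrite lt_def A0 andbT negbK => /eqP ->; rewrite mul0r.
pose s := (T 0%N + T 1%N) / 2.
have sab : T t < s < T t.+1 by rewrite /s /=; apply/andP; split; lra.
have nabla_gt0 : 0 < nabla f (x s) j.
  by rewrite lt_def nabla0 (pe_rate_defined run sab aj).
have [xs0 _] : vle 0 (x s) /\ vle (x s) (x (T m)).
  apply: (run_round_bounds (t := t) d0 nabla0 run).
  by case/andP: sab => /ltW -> /ltW ->.
pose r := `|M| / nabla f (x s) j.
have r0 : 0 <= r by rewrite divr_ge0.
exists (x s + r *: delta_mx 0 j).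
  by move=> i; have := xs0 i; rewrite !mxE => xsi; rewrite addr_ge0// mulr_ge0.
apply: le_trans (convex_tangent _ cvx (df (x s))).
rewrite (bigD1 j)//= big1 => [|i ij]; last first.
  by rewrite !mxE (negbTE ij) mulr0 addr0 subrr mul0r.
rewrite !mxE !eqxx mulr1 addr0 addrAC subrr add0r divfK ?gt_eqF//.
by rewrite (le_trans (ler_norm M))// lerDr.
Qed.

Lemma run_weighted_cost_le (R : realType) (m n d : nat) (f : 'rV[R]_n -> R)
    (A : 'M[R]_(m, n)) (T : nat -> R) (x : R -> 'rV[R]_n) (y : 'rV[R]_n) :
  (1 < d)%N -> (forall y, differentiable f y) ->
  (forall y l, 0 <= nabla f y l) ->
  (forall x y, vle x y -> forall l, nabla f x l <= nabla f y l) ->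
  (forall i j, 0 <= A i j) ->
  (forall i, (#|[pred j | A i j != 0%R]| <= d)%N) ->
  primal_execution f A d T x -> feasible A y ->
  5 / 4 * (f (x (T m)) - f 0) <=
  4 * ln (1 + 2 * d%:R ^+ 2) * \sum_(j < n) y 0 j * nabla f (x (T m)) j.
Proof.
move=> d1 df nabla0 nabla_mono A0 sparse run feas.
have d0 : (0 < d)%N by exact: ltnW.
have D2 : 2 <= d%:R :> R by rewrite (ler_nat R 2).
have D0 : 0 < d%:R :> R by rewrite ltr0n.
have p0 : 0 < d%:R^-1 :> R by rewrite invr_gt0.
have p2 : d%:R^-1 <= 1 / 2 :> R.
  by rewrite -[X in X <= _]mul1r ler_pdivrMr//; lra.
(* With [p = d^-1], this choice makes [(p + K) / p] equal to [1 + 2 * d ^ 2]. *)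
pose K : R := 2 * d%:R.
have K0 : 0 < K by rewrite mulr_gt0.
have pK : d%:R^-1 <= K by rewrite /K; lra.
have cost := run_cost_le d0 df A0 sparse run.
have time0 : 0 <= T m by rewrite -(pe_time0 run); exact: run_time_le run _ _ _ _.
have pot_ge := run_potential_ge d0 nabla0 nabla_mono A0 run feas K0 pK.
have pot_le := @potential_le R n (nabla f (x (T m))) y (x (T m)) d%:R^-1
  (d%:R^-1 + K) (nabla0 _) feas.1 (run_ge0 d0 nabla0 run (leqnn m)) p0
  ltac:(lra).
have ratioE : (d%:R^-1 + K) / d%:R^-1 = 1 + 2 * d%:R ^+ 2.
  by rewrite /K; field; rewrite gt_eqF.
rewrite ratioE in pot_le.
have KVE : K^-1 = d%:R^-1 / 2 by rewrite /K; field; rewrite gt_eqF.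
(* For [d >= 2] the subtracted terms [1 / (2 * d ^ 2)] and [1 / (2 * d)] are at most 1/8 and 1/4. *)
have rate : 5 / 8 <= 1 - d%:R^-1 / K - K^-1 by rewrite KVE; nra.
have := ler_wpM2r time0 rate; lra.
Qed.

(** * Assembly of the competitive ratio *)

Unset Implicit Arguments.

Theorem corollary2p6 (R : realType) (m n d : nat)
    (f : 'rV[R]_n -> R) (A : 'M[R]_(m, n))
    (m_gt0 : (0 < m)%N) (d_gt0 : (0 < d)%N)
    (f_ge0 : forall x, 0 <= f x)
    (f_nondecreasing : forall x y, vle x y -> f x <= f y)
    (f_convex : convex_function setT f)
    (f_continuous : continuous f)
    (f_differentiable : forall x, differentiable f x)
    (f_grad_monotone :
      forall x y, vle x y -> forall l, nabla f x l <= nabla f y l)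
    (A_ge0 : forall i j, 0 <= A i j)
    (A_sparse : forall i, (#|[pred j | A i j != 0%R]| <= d)%N)
    (T : nat -> R) (x : R -> 'rV[R]_n)
    (x_run : primal_execution f A d T x) :
  (primal_ratio f d * (f (x (T m)))%:E <= opt f A)%E.
Proof.
have nabla0 y l : 0 <= nabla f y l by exact: ge0_nabla.
apply/ereal_infP => _ [y feas <-].
have [y0 _] := feas.
have xm0 := run_ge0 d_gt0 nabla0 x_run (leqnn m).
set xm := x (T m) in xm0 *.
(* A product with 0 is 0 in the extended reals even if the ratio is infinite. *)
have [->|F_neq0] := eqVneq (f xm) 0; first by rewrite mule0 lee_fin.
have F0 : 0 < f xm by rewrite lt_def F_neq0 f_ge0.
have L0 := ln_coef_ge R d_gt0.
set L := ln _ in L0.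
have Lpos : 0 < L by lra.
have kE : (4 * L)^-1 = 1 / (4 * L) by rewrite mul1r.
suff ratio_le : (primal_ratio f d <= (f y / f xm)%:E)%E.
  have -> : (f y)%:E = ((f y / f xm)%:E * (f xm)%:E)%E.
    by rewrite -EFinM divfK ?gt_eqF.
  by rewrite lee_wpmul2r// lee_fin.
apply/ereal_supP => _ [c /= c0 <-].
have f0y : f 0 <= f y by exact: f_nondecreasing.
have inf_le z : vle 0 z -> f (c *: z) != 0 ->
    (ratio_at f d c z <= (f y / f xm)%:E)%E ->
    (ereal_inf [set ratio_at f d c z |
       z in [set z | vle 0%R z /\ f (c *: z) != 0%R]] <= (f y / f xm)%:E)%E.
  by move=> z0 fz r_le; apply: ge_ereal_inf; exists (ratio_at f d c z); first by exists z.
have scale_ge0 u : vle 0 u -> vle 0 (c^-1 *: u).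
  by move=> u0 j; have := u0 j; rewrite !mxE => uj; rewrite mulr_ge0 ?invr_ge0 ?(ltW c0).
have cK u : c *: (c^-1 *: u) = u by rewrite scalerA divff ?scale1r ?gt_eqF.
(* A point with [f u >= 20 * f 0 + 1] makes [f 0 / f u] at most 1/20, so the infimum is at most
   [k + 1 / 20] for any admissible [k]. *)
have by_large_point (k : R) : (4 * L)^-1 <= k -> k <= 3 / 10 ->
    k + 1 / 20 <= f y / f xm ->
    (ereal_inf [set ratio_at f d c z |
       z in [set z | vle 0%R z /\ f (c *: z) != 0%R]] <= (f y / f xm)%:E)%E.
  move=> Lk k3 k_le; have f0 := f_ge0 0.
  have [u u0 fu] := run_unbounded (20 * f 0 + 1) m_gt0 d_gt0 f_ge0 f_convex
    f_differentiable nabla0 A_ge0 x_run.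
  have fu0 : 0 < f u by lra.
  apply: (inf_le (c^-1 *: u)); rewrite ?cK ?gt_eqF//; first exact: scale_ge0.
  apply: le_trans (ratio_at_le f_convex f_differentiable nabla0 c0 u0 _ f0 Lpos _) _.
  - lra.
  - rewrite -/L; have := ler_wpM2r (ltW fu0) (le_trans Lk k3); lra.
  - rewrite lee_fin -/L; apply: le_trans k_le; rewrite lerD//.
    by rewrite ler_pdivrMr//; lra.
have [d1|d_le1] := ltnP 1 d; last first.
  have dE : d = 1%N by apply/eqP; rewrite eqn_leq d_le1.
  (* The value 3/10 comes from [L >= 5 / 6]. *)
  apply: (by_large_point (3 / 10)) => //.
    by rewrite kE ler_pdivrMr ?mulr_gt0//; lra.
  apply: (@le_trans _ _ 1); first lra.
  rewrite ler_pdivlMr// mul1r f_nondecreasing//.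
  move: A_sparse x_run; rewrite dE => sparse run.
  exact: run_vle_feasible nabla0 A_ge0 sparse run feas.
have [f0_large|f0_small] := ltP (f xm - f 0) (4 * f 0).
  have L2 := ln_coef_ge2 R d1; rewrite -/L in L2.
  (* Here [f xm < 5 * f 0] gives [f y / f xm > 1 / 5 = 3 / 20 + 1 / 20], and [L >= 5 / 3] gives the
     value 3/20. *)
  apply: (by_large_point (3 / 20)); last 2 first.
  - lra.
  - by rewrite ler_pdivlMr//; lra.
  by rewrite kE ler_pdivrMr ?mulr_gt0//; lra.
set z := c^-1 *: xm.
apply: (inf_le z); rewrite ?cK//; first exact: scale_ge0.
have tangent_xm := convex_tangent0 f_convex (f_differentiable xm).
have f0 := f_ge0 0.
have nabla_xm : exists l, nabla f (c *: z) l != 0.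
  apply/existsP; rewrite cK -[X in is_true X]negbK negb_exists.
  apply/negP => /forallP nabla_eq0; move: tangent_xm.
  rewrite big1 => [|l _]; first lra.
  by have := nabla_eq0 l; rewrite negbK => /eqP ->; rewrite mulr0.
have [rho [rho0 rho_le ->]] := ratio_at_fin d nabla0 nabla_xm.
rewrite lee_fin -/L cK ler_pdivlMr// mulrBl divfK ?gt_eqF//.
have cover := run_weighted_cost_le d1 f_differentiable nabla0 f_grad_monotone
  A_ge0 A_sparse x_run feas.
rewrite -/xm -/L in cover.
set W := \sum_(j < n) y 0 j * _ in cover.
(* In this case [4 * f 0 <= f xm - f 0], so [f xm] is at most 5/4 of [f xm - f 0]. *)
have kFW : (4 * L)^-1 * f xm <= W.
  rewrite mulrC ler_pdivrMr ?mulr_gt0// mulrC; apply: le_trans cover; lra.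
have tangent_y := convex_tangent y f_convex (f_differentiable z).
have split_sum : \sum_(l < n) (y 0 l - z 0 l) * nabla f z l =
    \sum_(l < n) y 0 l * nabla f z l - \sum_(l < n) z 0 l * nabla f z l.
  by rewrite -sumrB; apply: eq_bigr => l _; rewrite mulrBl.
(* The quotient minimum [rho] moves the bound on [W] from the gradient at [xm] to the gradient at
   [z], where the tangent is taken. *)
have rhoW : rho * W <= \sum_(l < n) y 0 l * nabla f z l.
  rewrite mulr_sumr; apply: ler_sum => l _; rewrite mulrCA ler_wpM2l//.
    by have := y0 l; rewrite mxE.
  by have := rho_le l; rewrite cK.
have := ler_wpM2l rho0 kFW; rewrite split_sum in tangent_y; lra.
Qed.
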